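(* Let $p,q$ be positive integers. For every positive integer $k$ there exists an integer $N=N(p,q,k)$ such that for every $n\geq N$ and all positive integers $b_1\leq \ldots \leq b_n$ satisfying $\frac{1}{N}\sum_{i=1}^{N} b_i\leq k$, Enforcer has a winning strategy in the game monotone-$mBox(b_1, \ldots, b_n,(p,q))$, both as the first and as the second player.
   Context: In a $(p,q)$ Avoider-Enforcer game on a finite board $X$ with target family $\mathcal F\subseteq 2^X$ played according to the monotone rules, Avoider and Enforcer alternately claim at least $p$ and at least $q$ previously unclaimed elements of $X$ per move, respectively; if fewer than $p$ (resp. $q$) unclaimed elements remain before Avoider's (resp. Enforcer's) move, he claims all of them. It is specified which player moves first. The game ends when all elements are claimed; Avoider loses (Enforcer wins) if at the end Avoider has claimed all elements of some target set, otherwise Avoider wins. The game monotone-$mBox(b_1,\ldots,b_n,(p,q))$ is this game (monotone rules) on the board consisting of the disjoint union of pairwise disjoint sets (boxes) $B_1,\ldots,B_n$ with $|B_i|=b_i$, with target sets exactly $B_1,\ldots,B_n$. *)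

(* Defs.v *)
From mathcomp Require Import all_boot all_order all_algebra.

Set Implicit Arguments.
Unset Strict Implicit.
Unset Printing Implicit Defensive.

Inductive player := Avoider | Enforcer.

Definition opponent (P : player) : player :=
  if P is Avoider then Enforcer else Avoider.

Record game := Game {
  board : finType;
  targets : {set {set board}};
  bias : player -> nat
}.

Section MonotoneRules.

Variables (G : game) (first : player).

(* The sequence of sets claimed so far, in chronological order. *)
Definition history := seq {set board G}.

Definition unclaimed (h : history) : {set board G} := ~: \bigcup_(M <- h) M.

Definition to_move (h : history) : player :=
  if odd (size h) then opponent first else first.

Definition legal_move (h : history) (M : {set board G}) : bool :=
  if #|unclaimed h| < bias G (to_move h) then M == unclaimed h
  else (M \subset unclaimed h) && (bias G (to_move h) <= #|M|).

(* No move is made once the whole board has been claimed. *)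
Definition is_play (h : history) : Prop :=
  forall t, t < size h ->
    unclaimed (take t h) != set0 /\ legal_move (take t h) (nth set0 h t).

Definition complete (h : history) : Prop := unclaimed h = set0.

Fixpoint avoider_claims (P : player) (h : history) : {set board G} :=
  if h is M :: h' then
    (if P is Avoider then M else set0) :|: avoider_claims (opponent P) h'
  else set0.

Definition enforcer_wins (h : history) : Prop :=
  exists2 F, F \in targets G & F \subset avoider_claims first h.

(* The legality requirement keeps [enforcer_winning] from holding vacuously
   for a strategy that gets stuck. *)
Definition enforcer_strategy (s : history -> {set board G}) : Prop :=
  forall h, is_play h -> unclaimed h != set0 -> to_move h = Enforcer ->
    legal_move h (s h).

Definition follows (s : history -> {set board G}) (h : history) : Prop :=
  forall t, t < size h -> to_move (take t h) = Enforcer ->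
    nth set0 h t = s (take t h).

Definition enforcer_winning (s : history -> {set board G}) : Prop :=
  forall h, is_play h -> complete h -> follows s h -> enforcer_wins h.

Definition enforcer_has_winning_strategy : Prop :=
  exists2 s, enforcer_strategy s & enforcer_winning s.

End MonotoneRules.

Section BoxGame.

Variables (n : nat) (b : 'I_n -> nat).

Definition box_board : finType := {i : 'I_n & 'I_(b i)}.

Definition box (i : 'I_n) : {set box_board} := [set x | tag x == i].

Lemma card_box (i : 'I_n) : #|box i| = b i.
Proof.
have -> : box i = [set Tagged (fun i => 'I_(b i)) y | y : 'I_(b i)].
  apply/setP=> -[j y]; rewrite inE /=; apply/eqP/imsetP => [ji|[z _ /(congr1 tag)]//].
  by case: i / ji; exists y.
rewrite card_imset ?card_ord // => y z /eqP.
by rewrite -tag_eqE /tag_eq /= eqxx tagged_asE => /eqP.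
Qed.

Definition mBox (p q : nat) : game :=
  @Game box_board [set box i | i : 'I_n]
    (fun P => if P is Avoider then p else q).

End BoxGame.

(* Main.v *)
Require Import Defs.
From mathcomp Require Import all_boot all_order all_algebra.
From mathcomp Require Import ring lra.

Set Implicit Arguments.
Unset Strict Implicit.
Unset Printing Implicit Defensive.

Import Order.TTheory GRing.Theory Num.Theory.

(** Whenever Enforcer moves he claims all that remains of some boxes, so that
    the unclaimed elements always lie in boxes he has never touched. Keeping
    the [q * j] boxes with the fewest unclaimed elements, going from [j.+1] to
    [j], does not increase the average number of unclaimed elements per box,
    while Avoider's next move lowers that average by at least [1 / (q * j)].
    Since the harmonic series diverges, enough boxes of bounded average size
    force the average below [1], that is, Avoider has filled a box. *)

(** * Plays extended by one move, and strategies that maintain an invariant *)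

Section Histories.

Variables (G : game) (first : player).
Implicit Types (h : history G) (M : {set board G}).

Lemma unclaimed_rcons h M : unclaimed (rcons h M) = unclaimed h :\: M.
Proof. by rewrite /unclaimed -cats1 big_cat big_seq1 /= setCU setDE setIC. Qed.

Lemma to_move_rcons h M :
  to_move first (rcons h M) = opponent (to_move first h).
Proof. by rewrite /to_move size_rcons /=; case: odd; case: (first). Qed.

Lemma avoider_claims_rcons h M :
  avoider_claims first (rcons h M) =
  avoider_claims first h :|:
    (if to_move first h is Avoider then M else set0).
Proof.
rewrite /to_move; elim: h first => [|M' h IHh] P /=.
  by rewrite setUC.
by rewrite IHh setUA; case: odd; case: P.
Qed.

Lemma legal_move_sub h M : legal_move first h M -> M \subset unclaimed h.
Proof. by rewrite /legal_move; case: ifP => [_ /eqP->|_ /andP[]]. Qed.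

Lemma legal_move_neq0 h M : 0 < bias G (to_move first h) ->
  unclaimed h != set0 -> legal_move first h M -> M != set0.
Proof.
move=> b_gt0 U0; rewrite /legal_move; case: ifP => [_ /eqP->//|_ /andP[_ leM]].
by rewrite -card_gt0 (leq_trans b_gt0).
Qed.

Lemma legal_move_unclaimed h : legal_move first h (unclaimed h).
Proof. by rewrite /legal_move; case: ltnP => //=; rewrite subxx. Qed.

Lemma is_play_rcons h M : is_play first (rcons h M) ->
  [/\ is_play first h, unclaimed h != set0 & legal_move first h M].
Proof.
move=> play; split; last 2 first.
- have := play (size h); rewrite size_rcons ltnS leqnn => /(_ isT)[].
  by rewrite -cats1 take_size_cat.
- have := play (size h); rewrite size_rcons ltnS leqnn => /(_ isT)[_].
  by rewrite nth_rcons ltnn eqxx -cats1 take_size_cat.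
move=> t lt_t; have := play t; rewrite size_rcons ltnS (ltnW lt_t) => /(_ isT).
by rewrite nth_rcons lt_t -cats1 takel_cat // ltnW.
Qed.

Lemma follows_rcons s h M : follows first s (rcons h M) ->
  follows first s h /\ (to_move first h = Enforcer -> M = s h).
Proof.
move=> fol; split; last first.
  have := fol (size h); rewrite size_rcons ltnS leqnn => /(_ isT).
  by rewrite nth_rcons ltnn eqxx -cats1 take_size_cat.
move=> t lt_t; have := fol t; rewrite size_rcons ltnS (ltnW lt_t) => /(_ isT).
by rewrite nth_rcons lt_t -cats1 takel_cat // ltnW.
Qed.

(** Enforcer always answers with a legal move that restores [inv]. By induction on the last move,
    every play following this strategy stays inside [inv]. *)
Lemma enforcer_wins_by_invariant (inv : pred (history G)) :
  inv [::] ->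
  (forall h M, inv h -> unclaimed h != set0 -> to_move first h = Avoider ->
     legal_move first h M -> inv (rcons h M)) ->
  (forall h, inv h -> unclaimed h != set0 -> to_move first h = Enforcer ->
     exists2 M, legal_move first h M & inv (rcons h M)) ->
  (forall h, inv h -> complete h -> enforcer_wins first h) ->
  enforcer_has_winning_strategy G first.
Proof.
move=> inv0 invA invE inv_wins.
(* Claiming everything left is always legal, so this default keeps [s] a legal strategy even at
   histories where [inv] fails. *)
pose s h := odflt (unclaimed h)
  [pick M | legal_move first h M && inv (rcons h M)].
exists s => [h _ _ _|h].
  by rewrite /s; case: pickP => [M /andP[]//|_]; apply: legal_move_unclaimed.
move=> play compl fol; apply: inv_wins compl.
elim/last_ind: h play fol => [//|h M IHh] /is_play_rcons[play U0 legM].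
move=> /follows_rcons[fol Ms]; have {IHh}invh := IHh play fol.
case E: (to_move first h); first exact: invA.
rewrite (Ms E) /s; case: pickP => [M' /andP[]//|no_move].
have [M' legM' invM'] := invE h invh U0 E.
by have := no_move M'; rewrite legM' invM'.
Qed.

End Histories.

(** * Averages over the smallest terms *)

Section SmallestTerms.

Variables (T : finType) (f : T -> nat).

(** Discarding a largest term does not raise the average; repeat until [m] terms are left. The
    averages are compared by cross-multiplication, to stay in [nat]. *)
Lemma subset_below_average (I : {set T}) m : m <= #|I| ->
  exists J : {set T}, [/\ J \subset I, #|J| = m &
    #|I| * \sum_(i in J) f i <= m * \sum_(i in I) f i].
Proof.
move eq_c: #|I| => c.
elim: c I eq_c => [|c IHc] I cardI le_m.
  by exists set0; rewrite sub0set cards0 mul0n; split=> //; case: m le_m.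
have [->|neq_m] := eqVneq m c.+1; first by exists I.
have {neq_m} le_mc : m <= c by rewrite -ltnS ltn_neqAle neq_m le_m.
have [i0 i0I] : exists i0, i0 \in I by apply/card_gt0P; rewrite cardI.
have [x xI max_x] : exists2 x, x \in I & forall i, i \in I -> f i <= f x.
  by have [x] := arg_maxnP f i0I; exists x.
have cardI1 : #|I :\ x| = c.
  by apply/eqP; rewrite -eqSS -cardI (cardsD1 x I) xI.
have [J [sJ cardJ leJ]] := IHc _ cardI1 le_mc.
exists J; split=> //; first exact: subset_trans sJ (subsetDl _ _).
have sumI : \sum_(i in I) f i = f x + \sum_(i in I :\ x) f i.
  by rewrite (big_setD1 x).
have le_avg : \sum_(i in I :\ x) f i <= c * f x.
  rewrite -cardI1 -sum_nat_const; apply: leq_sum => i /setD1P[_ iI].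
  exact: max_x.
(* For [c = 0] the factor [c] cannot be cancelled, but then [J] is empty. *)
have [c0|c_gt0] := posnP c.
  move: cardJ le_mc; rewrite c0 leqn0 => cardJ /eqP m0.
  by move/eqP: cardJ; rewrite m0 cards_eq0 => /eqP->; rewrite big_set0.
rewrite -(leq_pmul2l c_gt0) mulnCA (leq_trans (leq_mul (leqnn c.+1) leJ)) //.
rewrite sumI mulnCA [leqRHS]mulnCA leq_mul2l; apply/orP; right.
by rewrite mulnDr mulSn leq_add2r.
Qed.

End SmallestTerms.

(** * Divergence of the harmonic series *)

Section Harmonic.

Local Open Scope ring_scope.

Definition harmonic_sum (j : nat) : rat := \sum_(i < j) i.+1%:R^-1.

Lemma harmonic_sumS j :
  harmonic_sum j.+1 = harmonic_sum j + j.+1%:R^-1.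
Proof. by rewrite /harmonic_sum big_ord_recr. Qed.

(** Each of the [m] additional terms is at least [1 / (2 * m)]. *)
Lemma harmonic_sum_double m : (0 < m)%N ->
  harmonic_sum m + 2^-1 <= harmonic_sum (m + m).
Proof.
move=> m_gt0; rewrite /harmonic_sum big_split_ord /= lerD2l.
apply: (@le_trans _ _ (\sum_(i < m) (m + m)%:R^-1)).
  have m_neq0 : m%:R != 0 :> rat by rewrite pnatr_eq0 -lt0n.
  rewrite sumr_const card_ord addnn -mul2n natrM -[leRHS]mulr_natr.
  by rewrite invfM mulfVK.
apply: ler_sum => i _; rewrite lef_pV2 ?posrE ?ltr0n ?addn_gt0 ?m_gt0 //.
by rewrite ler_nat ltn_add2l.
Qed.

Lemma harmonic_sum_exp2 r : r%:R / 2 <= harmonic_sum (2 ^ r).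
Proof.
elim: r => [|r IHr]; first by rewrite mul0r /harmonic_sum big_ord1 invr1.
rewrite expnS mul2n -addnn.
have /harmonic_sum_double : (0 < 2 ^ r)%N by rewrite expn_gt0.
rewrite -(natr1 r); lra.
Qed.

End Harmonic.

(** * Counting unclaimed elements in boxes, and the threshold of scarcity *)

Section Boxes.

Variables (n : nat) (b : 'I_n -> nat) (p q : nat) (first : player).
Hypotheses (p_gt0 : 0 < p) (q_gt0 : 0 < q).

Let G := mBox b p q.
Implicit Types (h : history G) (M U : {set board G}) (I : {set 'I_n}).

Definition boxes I : {set box_board b} := [set x | tag x \in I].

Lemma box_sub_boxes I i : i \in I -> box b i \subset boxes I.
Proof. by move=> iI; apply/subsetP => x; rewrite !inE => /eqP->. Qed.

Lemma card_boxesI (U : {set box_board b}) I :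
  #|U :&: boxes I| = \sum_(i in I) #|U :&: box b i|.
Proof.
rewrite -sum1_card (partition_big (fun x => tag x) (mem I)) /=; last first.
  by move=> x; rewrite !inE => /andP[].
apply: eq_bigr => i iI; rewrite -sum1_card; apply: eq_bigl => x.
by rewrite !inE -andbA; case: eqP => [->|]; rewrite ?iI ?andbF.
Qed.

Lemma leq_card_boxesI (U : {set box_board b}) I :
  (forall i, i \in I -> U :&: box b i != set0) -> #|I| <= #|U :&: boxes I|.
Proof.
move=> neq0; rewrite card_boxesI -sum1_card; apply: leq_sum => i iI.
by rewrite card_gt0 neq0.
Qed.

(* The threshold [t j] solves [t j.+1 = j.+1 / j * t j + 1] with [t 1 = q + 1]:
   one unit for Avoider's move, then averaging for Enforcer's. *)
Definition scarce (j u : nat) : bool :=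
  (u%:R < (q * j)%:R + j%:R * harmonic_sum j)%R.

Lemma scarce1 u : scarce 1 u = (u <= q).
Proof.
rewrite /scarce muln1 mul1r /harmonic_sum big_ord1 invr1.
by rewrite natr1 ltr_nat ltnS.
Qed.

(** This is one round: Avoider's move takes [u] to [u1], which pays for the last harmonic term,
    worth [j.+1 * j.+1^-1 = 1] in the threshold; keeping the smallest boxes then scales the count by
    [j / j.+1]. *)
Lemma scarceS j u u1 u' : 0 < j -> scarce j.+1 u -> u1 < u ->
  j.+1 * u' <= j * u1 -> scarce j u'.
Proof.
rewrite /scarce harmonic_sumS => j_gt0 lt_u lt_u1.
rewrite -(ler_nat rat) !natrM => le_u'.
have K_gt0 : (0 < j.+1%:R :> rat)%R by rewrite ltr0n.
have J_gt0 : (0 < j%:R :> rat)%R by rewrite ltr0n.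
rewrite -(ltr_pM2l K_gt0); apply: le_lt_trans le_u' _.
have -> : (j.+1%:R * (q%:R * j%:R + j%:R * harmonic_sum j) =
  j%:R * (q%:R * j.+1%:R + j.+1%:R * harmonic_sum j) :> rat)%R by ring.
rewrite ltr_pM2l //; move: lt_u lt_u1.
rewrite -(ler_nat rat) natrM mulrDr divff ?gt_eqF // -(natr1 u1); lra.
Qed.

(** * Enforcer's invariant and its preservation *)

Definition filled h : bool :=
  [exists i, box b i \subset avoider_claims first h].

(** The last clause says that Enforcer has touched no box of [I]. *)
Definition promising h j I : bool :=
  [&& 0 < j, #|I| == q * j, scarce j #|unclaimed h :&: boxes I| &
   [forall i in I, box b i \subset unclaimed h :|: avoider_claims first h]].

(* The first disjunct is for Avoider opening the game, when Enforcer has not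
   yet discarded the large boxes. *)
Definition box_invariant h : bool :=
  [|| (if first is Avoider then nilp h else false), filled h |
   [exists I : {set 'I_n}, promising h (#|I| %/ q) I &&
     (if to_move first h is Avoider then unclaimed h \subset boxes I
      else q <= #|unclaimed h :\: boxes I|)]].

Lemma box_invariantI h j I : promising h j I ->
  (if to_move first h is Avoider then unclaimed h \subset boxes I
   else q <= #|unclaimed h :\: boxes I|) -> box_invariant h.
Proof.
move=> prom turn; apply/or3P/Or33/existsP; exists I; rewrite turn andbT.
by have /and4P[_ /eqP-> _ _] := prom; rewrite mulKn.
Qed.

Lemma filled_rcons h M : filled h -> filled (rcons h M).
Proof.
case/existsP=> i fill; apply/existsP; exists i.
by rewrite avoider_claims_rcons (subset_trans fill) ?subsetUl.
Qed.

Lemma not_filled h i : ~~ filled h ->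
  box b i \subset unclaimed h :|: avoider_claims first h ->
  unclaimed h :&: box b i != set0.
Proof.
move=> /existsPn/(_ i) nfill sub; apply: contraNneq nfill => U0.
apply/subsetP => x xi; have := subsetP sub x xi; rewrite inE => /orP[xU|//].
by have := in_set0 x; rewrite -U0 inE xU xi.
Qed.

Lemma invariant_enforcer h : box_invariant h -> to_move first h = Enforcer ->
  exists2 M, legal_move first h M & box_invariant (rcons h M).
Proof.
move=> inv turn; have [fill|nfill] := boolP (filled h).
  exists (unclaimed h); first exact: legal_move_unclaimed.
  by rewrite /box_invariant filled_rcons ?orbT.
move: inv; rewrite /box_invariant (negPf nfill) turn.
have -> /= : (if first is Avoider then nilp h else false) = false.
  by move: turn; rewrite /to_move; case: (first) => //; case: h {nfill}.
case/existsP => I /andP[/and4P[j_gt0 cardI sc unt] leq].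
(* Enforcer claims everything outside the kept boxes; the invariant guarantees the [q] elements that
   make this legal. *)
exists (unclaimed h :\: boxes I).
  rewrite /legal_move turn /= subsetDl leq ltnNge.
  by rewrite (leq_trans leq) ?subset_leq_card ?subsetDl.
have eqU : unclaimed (rcons h (unclaimed h :\: boxes I)) =
    unclaimed h :&: boxes I.
  by rewrite unclaimed_rcons setDDr setDv set0U.
apply: (@box_invariantI _ (#|I| %/ q) I); last first.
  by rewrite to_move_rcons turn /= eqU subsetIr.
rewrite /promising j_gt0 cardI eqU -setIA setIid sc /=.
apply/forall_inP => i iI; rewrite avoider_claims_rcons turn setU0.
apply/subsetP => x xi; have := subsetP (forall_inP unt i iI) x xi.
by rewrite in_setU in_setU in_setI (subsetP (box_sub_boxes iI) _ xi) andbT.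
Qed.

(** This serves both openings: Enforcer is about to make his first move, whether or not Avoider has
    already moved. The first [q * J] boxes are kept. *)
Lemma invariant_start J h : 0 < J -> q * J.+1 <= n ->
  scarce J (\sum_(i < n | i < q * J) b i) ->
  unclaimed h :|: avoider_claims first h = setT -> to_move first h = Enforcer ->
  box_invariant h.
Proof.
move=> J_gt0 le_n sc all_in turn.
have [fill|nfill] := boolP (filled h).
  by rewrite /box_invariant fill orbT.
pose K := [set i : 'I_n | i < q * J].
have cardK : #|K| = q * J.
  have le_qJ : q * J <= n.
    by rewrite (leq_trans _ le_n) // leq_mul2l leqnSn orbT.
  rewrite -sum1_card (eq_bigl (fun i : 'I_n => i < q * J)); last first.
    by move=> i; rewrite inE.
  by rewrite -(big_ord_widen n (fun=> 1)) // sum1_card card_ord.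
apply: (@box_invariantI _ J K).
  rewrite /promising J_gt0 cardK eqxx /=; apply/andP; split; last first.
    by apply/forall_inP => i _; rewrite all_in subsetT.
  apply: le_lt_trans sc; rewrite ler_nat card_boxesI.
  rewrite (eq_bigl (fun i : 'I_n => i < q * J)); last by move=> i; rewrite inE.
  by apply: leq_sum => i _; rewrite -(card_box b) subset_leq_card ?subsetIr.
rewrite turn.
have -> : unclaimed h :\: boxes K = unclaimed h :&: boxes (~: K).
  by apply/setP=> x; rewrite !inE andbC.
(* At least [q] boxes lie outside [K], and each still has an unclaimed element since no box is
   filled. *)
apply: leq_trans (leq_card_boxesI _) => [|i _].
  by rewrite cardsCs setCK card_ord cardK leq_subRL ?(leq_trans _ le_n) //
    ?leq_mul2l ?leqnSn ?orbT // addnC -mulnS.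
by apply: not_filled; rewrite // all_in subsetT.
Qed.

(** Unless a box gets filled, every box of [I] keeps an unclaimed element. The boxes to keep next
    are chosen here, before Enforcer's reply, so that the [q] discarded ones supply that reply. *)
Lemma invariant_avoider h M j I : promising h j I ->
  unclaimed h \subset boxes I -> unclaimed h != set0 ->
  to_move first h = Avoider -> legal_move first h M ->
  box_invariant (rcons h M).
Proof.
move=> /and4P[j_gt0 /eqP cardI sc unt] subU U0 turn legM.
have [fill|nfill] := boolP (filled (rcons h M)).
  by rewrite /box_invariant fill orbT.
have subM := legal_move_sub legM.
have M0 : M != set0 by apply: (legal_move_neq0 _ U0 legM); rewrite turn.
set U1 := unclaimed (rcons h M).
have U1E : U1 = unclaimed h :\: M by exact: unclaimed_rcons.
have ltU1 : #|U1| < #|unclaimed h|.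
  by rewrite U1E cardsD (setIidPr subM) ltn_subrL !card_gt0 M0.
have unt1 i : i \in I ->
    box b i \subset U1 :|: avoider_claims first (rcons h M).
  move=> iI; rewrite U1E avoider_claims_rcons turn.
  apply/subsetP => x xi; have := subsetP (forall_inP unt i iI) x xi.
  by rewrite !inE; case/orP=> ->; case: (x \in M); rewrite ?orbT.
have live i : i \in I -> U1 :&: box b i != set0.
  by move=> iI; apply: not_filled => //; apply: unt1.
have capU1 : U1 :&: boxes I = U1.
  by apply/setIidPl; rewrite U1E (subset_trans (subsetDl _ _)).
rewrite (setIidPl subU) in sc.
(* With [q] boxes left, at most [q] elements were unclaimed before the move, hence fewer than [q]
   after it: some box must be filled. *)
case: j j_gt0 cardI sc => // -[|j] _ cardI sc.
  have := leq_card_boxesI live; rewrite capU1 cardI muln1 leqNgt.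
  by rewrite scarce1 in sc; rewrite (leq_trans ltU1 sc).
have [|I' [subI' cardI' leI']] :=
    @subset_below_average _ (fun i => #|U1 :&: box b i|) I (q * j.+1).
  by rewrite cardI leq_mul2l leqnSn orbT.
apply: (@box_invariantI _ j.+1 I').
  rewrite /promising /= cardI' eqxx /= -/U1; apply/andP; split; last first.
    by apply/forall_inP => i /(subsetP subI'); apply: unt1.
  apply: scarceS sc ltU1 _ => //.
  by move: leI'; rewrite cardI -!card_boxesI capU1 -!mulnA leq_pmul2l.
rewrite to_move_rcons turn /= -/U1.
(* Each of the [q] boxes in [I :\: I'] contributes an element to Enforcer's next move. *)
apply: (@leq_trans #|U1 :&: boxes (I :\: I')|).
  apply: leq_trans (leq_card_boxesI _) => [|i /setDP[iI _]]; last exact: live.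
  by rewrite cardsD (setIidPr subI') cardI cardI' -mulnBr subSnn muln1.
apply/subset_leq_card/subsetP => x; rewrite !inE.
by case/and3P=> -> ->.
Qed.

Lemma enforcer_wins_boxes J : 0 < J -> q * J.+1 <= n ->
  scarce J (\sum_(i < n | i < q * J) b i) ->
  enforcer_has_winning_strategy G first.
Proof.
move=> J_gt0 le_n sc.
apply: (@enforcer_wins_by_invariant _ _ box_invariant).
- case E: first; first by rewrite /box_invariant E.
  apply: invariant_start J_gt0 le_n sc _ _; last by rewrite /to_move.
  by rewrite /unclaimed big_nil setC0 setTU.
- move=> h M /or3P[start|fill|/existsP[I /andP[prom subU]]] U0 turn legM.
  + have h0 : h = [::].
      by move: start; case: (first) => // /nilP.
    apply: invariant_start J_gt0 le_n sc _ _; last first.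
      by rewrite to_move_rcons turn.
    rewrite unclaimed_rcons avoider_claims_rcons turn h0 /unclaimed big_nil.
    by rewrite setC0 /= set0U setTD setUC setUCr.
  + by rewrite /box_invariant filled_rcons ?orbT.
  + by rewrite turn in subU; apply: invariant_avoider prom subU U0 turn legM.
- by move=> h inv _ turn; apply: invariant_enforcer.
move=> h + compl.
have wins i : box b i \subset avoider_claims first h -> enforcer_wins first h.
  by move=> sub; exists (box b i); rewrite ?imset_f.
case/or3P=> [start|/existsP[i /wins//]|
  /existsP[I /andP[/and4P[j_gt0 cardI _ unt] _]]].
  (* A complete game with no move played has an empty board, so any box is trivially contained in
     Avoider's claims. *)
  have h0 : h = [::] by move: start; case: (first) => // /nilP.
  have T0 : [set: board G] = set0 by rewrite -compl h0 /unclaimed big_nil setC0.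
  have n_gt0 : 0 < n by rewrite (leq_trans _ le_n) // muln_gt0 q_gt0.
  apply: (wins (Ordinal n_gt0)); apply/subsetP => x _.
  by have := in_setT x; rewrite T0 inE.
(* With nothing unclaimed, a box that Enforcer never touched belongs entirely to Avoider. *)
have [i iI] : exists i, i \in I.
  by apply/card_gt0P; rewrite (eqP cardI) muln_gt0 q_gt0.
by apply: (wins i); have := forall_inP unt i iI; rewrite compl set0U.
Qed.

End Boxes.

(** * The choice of [N] *)

Theorem theorem1p7 (p q : nat) (p_gt0 : 0 < p) (q_gt0 : 0 < q)
    (k : nat) (k_gt0 : 0 < k) :
  exists N : nat, 0 < N /\
    forall (n : nat), N <= n ->
    forall (b : 'I_n -> nat),
      (forall i, 0 < b i) ->
      (forall i j : 'I_n, i <= j -> b i <= b j) ->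
      (N%:R^-1 * (\sum_(i < n | (i < N)%N) (b i)%:R) <= k%:R :> rat)%R ->
      enforcer_has_winning_strategy (mBox b p q) Enforcer /\
      enforcer_has_winning_strategy (mBox b p q) Avoider.
Proof.
(* The exponent makes [harmonic_sum J] at least [2 * k * q]. *)
pose J := 2 ^ (4 * (k * q)).
have J_gt0 : 0 < J by rewrite expn_gt0.
have N_gt0 : 0 < q * J.+1 by rewrite muln_gt0 q_gt0.
(* There are [q * J] boxes to keep and [q] more for Enforcer's first move. *)
exists (q * J.+1); split=> // n le_n b _ _ avg.
suff sc : scarce q J (\sum_(i < n | i < q * J) b i).
  by split; apply: enforcer_wins_boxes sc.
(* The bound [k * q * J.+1] given by the average is relaxed using [J.+1 <= 2 * J], to be compared
   with [J * harmonic_sum J]. *)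
have le_sum : \sum_(i < n | i < q * J) b i <= k * q * (2 * J).
  have le_sumN : \sum_(i < n | i < q * J.+1) b i <= k * (q * J.+1).
    rewrite -(ler_nat rat) natr_sum natrM mulrC.
    by rewrite -ler_pdivrMl ?ltr0n.
  apply: (@leq_trans (k * (q * J.+1))); last first.
    by rewrite mulnA leq_mul2l mul2n -addnn -addn1 leq_add2l J_gt0 orbT.
  apply: leq_trans le_sumN; rewrite big_mkcond [leqRHS]big_mkcond /=.
  apply: leq_sum => i _; case: ifP => // lt_i.
  by rewrite (leq_trans lt_i) // leq_mul2l leqnSn orbT.
rewrite /scarce; apply: (@le_lt_trans _ _ ((k * q * (2 * J))%:R)%R).
  by rewrite ler_nat.
have qJ_gt0 : (0 < (q * J)%:R :> rat)%R by rewrite ltr0n muln_gt0 q_gt0.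
apply: (@le_lt_trans _ _ (J%:R * harmonic_sum J)%R); last first.
  by rewrite ltrDr.
have -> : ((k * q * (2 * J))%:R = J%:R * ((4 * (k * q))%:R / 2) :> rat)%R.
  by rewrite !natrM; field.
by rewrite ler_pM2l ?ltr0n // harmonic_sum_exp2.
Qed.
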